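(* Let $R$ be a commutative ring with unity, $(G,\alpha)$ an edge-labeled graph over $R$ with vertex set $V$, and $I$ an ideal of $R$; let $\overline{\alpha}$ be the edge labeling of $G$ over $R/I$ given by $\overline{\alpha}(uv)=\alpha(uv)+I$. Suppose there is a second ideal $J$ of $R$ with $I\cap J=(0)$. Then: (1) If $q:V\to R/I$ is a spline on $(G,\overline{\alpha})$ with $q(u)=x_u+I$ for each vertex $u$, and $j\in J$, then the function $q_j:V\to R$, $q_j(u)=x_uj$, is well defined (independent of the choice of representatives $x_u$) and is a spline on $(G,\alpha)$. (2) If moreover $R=I+J$, then there is a unique $j_0\in J$ such that $\overline{q_{j_0}}=q$ for every spline $q$ on $(G,\overline{\alpha})$, where $\overline{q_{j_0}}(u)=q_{j_0}(u)+I$.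
   Context: An edge labeling of a graph $G=(V,E)$ over a commutative ring $S$ is a function from $E$ to the set of ideals of $S$. A spline on a labeled graph $(G,\alpha)$ over $S$ is a function $p:V\to S$ with $p(u)-p(v)\in\alpha(uv)$ for every edge $uv$. *)

(* Defs.v *)
From HB Require Import structures.
From mathcomp Require Import all_boot all_algebra.
From mathcomp Require Import generic_quotient ring_quotient.
From mathcomp Require Import boolp classical_sets.

Set Implicit Arguments.
Unset Strict Implicit.
Unset Printing Implicit Defensive.

Import GRing.Theory.
Local Open Scope ring_scope.
Local Open Scope quotient_scope.

(* MathComp's idealr only covers proper ideals of nonzero rings; here the      *)
(* unit ideal and the zero ring are allowed. Predicates are boolean, which is  *)
(* no restriction since Prop is embedded in bool by asbool.                    *)
HB.mixin Record isIdeal (R : comPzRingType) (S : R -> bool) := {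
  ideal_mul_subproof : forall a, {in S, forall x, a * x \in S}
}.

#[short(type="ideal")]
HB.structure Definition Ideal (R : comPzRingType) :=
  {S of GRing.ZmodClosed R S & isIdeal R S}.

Lemma ideal_mull (R : comPzRingType) (I : ideal R) (a x : R) :
  x \in I -> a * x \in I.
Proof. exact: ideal_mul_subproof. Qed.

Lemma ideal_mulr (R : comPzRingType) (I : ideal R) (a x : R) :
  x \in I -> x * a \in I.
Proof. by rewrite mulrC; exact: ideal_mull. Qed.

Section SumIdeal.
Variables (R : comPzRingType) (I J : ideal R).

Definition ideal_sum_pred (x : R) : bool :=
  `[< exists a b, [/\ a \in I, b \in J & x = a + b] >].

Lemma ideal_sum_zmod_closed : zmod_closed ideal_sum_pred.
Proof.
split=> [|_ _ /asboolP[a [b [aI bJ ->]]] /asboolP[c [d [cI dJ ->]]]].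
  by apply/asboolP; exists 0, 0; rewrite !rpred0 addr0.
apply/asboolP; exists (a - c), (b - d); split; rewrite ?rpredB //.
by rewrite opprD addrACA.
Qed.

Lemma ideal_sum_mul a : {in ideal_sum_pred, forall x, a * x \in ideal_sum_pred}.
Proof.
move=> _ /asboolP[b [c [bI cJ ->]]]; apply/asboolP.
by exists (a * b), (a * c); rewrite mulrDr !ideal_mull.
Qed.

HB.instance Definition _ :=
  GRing.isZmodClosed.Build R ideal_sum_pred ideal_sum_zmod_closed.
HB.instance Definition _ := isIdeal.Build R ideal_sum_pred ideal_sum_mul.

Definition ideal_sum : ideal R := Ideal.clone R ideal_sum_pred _.

End SumIdeal.

(* R/I is the additive quotient of ring_quotient; it is renamed because the    *)
(* library attaches a ring structure to it only for proper I.                  *)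
Definition quoring (R : comPzRingType) (I : ideal R) : Type := Quotient.quot I.

Section QuotientRing.
Variables (R : comPzRingType) (I : ideal R).
Local Notation Q := (quoring I).

HB.instance Definition _ := ZmodQuotient.on Q.

Definition quo_pi (x : R) : Q := \pi_Q x.

Lemma quo_reprK (y : Q) : quo_pi (repr y) = y.
Proof. exact: reprK. Qed.

Lemma quo_piE (x y : R) : (quo_pi x == quo_pi y) = (x - y \in I).
Proof. by rewrite [x - y \in I]Quotient.idealrBE. Qed.

Lemma quo_piW (P : Q -> Prop) : (forall x, P (quo_pi x)) -> forall y, P y.
Proof. by move=> Ppi y; rewrite -[y]quo_reprK. Qed.

Lemma quo_pi_zmod_morphism : zmod_morphism quo_pi.
Proof. by move=> x y; rewrite /quo_pi raddfB. Qed.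

Definition quo_one : Q := quo_pi 1.
Definition quo_mul (x y : Q) : Q := quo_pi (repr x * repr y).

Lemma quo_mulE : {morph quo_pi : x y / x * y >-> quo_mul x y}.
Proof.
move=> x y; apply/eqP; rewrite quo_piE.
set x' := repr _; set y' := repr _.
have xI : x - x' \in I by rewrite -quo_piE quo_reprK.
have yI : y - y' \in I by rewrite -quo_piE quo_reprK.
rewrite -[x * y](subrK (x * y')) -mulrBr -addrA -mulrBl.
by apply: rpredD; [exact: ideal_mull | exact: ideal_mulr].
Qed.

HB.instance Definition _ :=
  GRing.isZmodMorphism.Build R Q quo_pi quo_pi_zmod_morphism.

Lemma quo_mulA : associative quo_mul.
Proof.
elim/quo_piW=> x; elim/quo_piW=> y; elim/quo_piW=> z.
by rewrite -!quo_mulE mulrA.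
Qed.

Lemma quo_mulC : commutative quo_mul.
Proof. by elim/quo_piW=> x; elim/quo_piW=> y; rewrite -!quo_mulE mulrC. Qed.

Lemma quo_mul1 : left_id quo_one quo_mul.
Proof. by elim/quo_piW=> x; rewrite -!quo_mulE mul1r. Qed.

Lemma quo_mulDl : left_distributive quo_mul +%R.
Proof.
elim/quo_piW=> x; elim/quo_piW=> y; elim/quo_piW=> z.
by rewrite -raddfD -!quo_mulE mulrDl raddfD.
Qed.

HB.instance Definition _ := GRing.Zmodule_isComPzRing.Build Q
  quo_mulA quo_mulC quo_mul1 quo_mulDl.

Lemma quo_pi_monoid_morphism : monoid_morphism quo_pi.
Proof. by split; [|exact: quo_mulE]. Qed.

HB.instance Definition _ :=
  GRing.isMonoidMorphism.Build R Q quo_pi quo_pi_monoid_morphism.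

End QuotientRing.

(* The image in R/I of an ideal K of R; for K containing I this is K/I.        *)
Section ImageIdeal.
Variables (R : comPzRingType) (I K : ideal R).
Local Notation Q := (quoring I).

Definition quo_ideal_pred (y : Q) : bool :=
  `[< exists x, x \in K /\ quo_pi I x = y >].

Lemma quo_ideal_zmod_closed : zmod_closed quo_ideal_pred.
Proof.
split=> [|_ _ /asboolP[a [aK <-]] /asboolP[b [bK <-]]].
  by apply/asboolP; exists 0; rewrite rpred0 raddf0.
by apply/asboolP; exists (a - b); rewrite rpredB // raddfB.
Qed.

Lemma quo_ideal_mul a : {in quo_ideal_pred, forall x, a * x \in quo_ideal_pred}.
Proof.
elim/quo_piW: a => a _ /asboolP[x [xK <-]]; apply/asboolP; exists (a * x).
by rewrite ideal_mull // rmorphM.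
Qed.

HB.instance Definition _ :=
  GRing.isZmodClosed.Build Q quo_ideal_pred quo_ideal_zmod_closed.
HB.instance Definition _ := isIdeal.Build Q quo_ideal_pred quo_ideal_mul.

Definition quo_ideal : ideal Q := Ideal.clone Q quo_ideal_pred _.

End ImageIdeal.

Arguments quo_ideal {R} I K.

Record graph := Graph {
  vertex : Type;
  edges : set (set vertex);
  edgesP : forall e, edges e -> exists u v, u <> v /\ e = [set u; v]%classic
}.

Definition edge (G : graph) : Type := {e : set (vertex G) | edges e}.

Definition edge_labeling (G : graph) (S : comPzRingType) : Type :=
  edge G -> ideal S.

Definition is_spline (G : graph) (S : comPzRingType)
    (alpha : edge_labeling G S) (p : vertex G -> S) : Prop :=
  forall (e : edge G) (u v : vertex G),
    sval e = [set u; v]%classic -> p u - p v \in alpha e.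

Definition quo_labeling (G : graph) (R : comPzRingType) (I : ideal R)
    (alpha : edge_labeling G R) : edge_labeling G (quoring I) :=
  fun e => quo_ideal I (ideal_sum (alpha e) I).

(* The function q_j, computed with the representatives chosen by repr.         *)
Definition lift_mul (V : Type) (R : comPzRingType) (I : ideal R)
    (q : V -> quoring I) (j : R) : V -> R :=
  fun u => repr (q u) * j.

(* Main.v *)
(* I and J annihilate each other because IJ is contained in their intersection,
   which is zero; hence multiplication by j in J forgets everything modulo I.
   If 1 = i0 + j0 with i0 in I and j0 in J, then j0 is congruent to 1 modulo I,
   so j0 works. Testing on the constant spline 1 shows that any other choice is
   also congruent to 1 modulo I, hence differs from j0 by an element of the
   intersection of I and J. *)
Require Import Defs.
From HB Require Import structures.
From mathcomp Require Import all_boot all_algebra.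
From mathcomp Require Import boolp classical_sets.

Import GRing.Theory.

Local Open Scope ring_scope.

Lemma ideal_mul_eq0 (R : comPzRingType) (I J : ideal R) (x y : R) :
  (forall z : R, (z \in I) && (z \in J) = (z == 0)) ->
  x \in I -> y \in J -> x * y = 0.
Proof.
by move=> IJ0 xI yJ; apply/eqP; rewrite -IJ0 (ideal_mulr _ xI) ideal_mull.
Qed.

Lemma quo_pi_mulr_eq (R : comPzRingType) (I J : ideal R) (x y j : R) :
  (forall z : R, (z \in I) && (z \in J) = (z == 0)) ->
  j \in J -> quo_pi I x = quo_pi I y -> x * j = y * j.
Proof.
move=> IJ0 jJ /eqP; rewrite quo_piE => xyI; apply/eqP.
by rewrite -subr_eq0 -mulrBl (ideal_mul_eq0 _ _ _ _ _ IJ0).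
Qed.

(** Reduction modulo [I] is multiplicative, so the lift recovers [q] as soon as the class of [j] is
    1. *)
Lemma quo_pi_lift_mul (V : Type) (R : comPzRingType) (I : ideal R)
    (q : V -> quoring I) (j : R) (u : V) :
  quo_pi I (lift_mul q j u) = q u * quo_pi I j.
Proof. by rewrite /lift_mul (rmorphM (quo_pi I)) /= quo_reprK. Qed.

Lemma is_spline_const (G : graph) (S : comPzRingType) (alpha : edge_labeling G S)
    (c : S) : is_spline alpha (fun=> c).
Proof. by move=> e u v _; rewrite subrr rpred0. Qed.

Lemma is_spline_lift_mul (R : comPzRingType) (G : graph)
    (alpha : edge_labeling G R) (I J : ideal R) (q : vertex G -> quoring I)
    (j : R) :
  (forall z : R, (z \in I) && (z \in J) = (z == 0)) ->
  is_spline (quo_labeling I alpha) q -> j \in J ->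
  is_spline alpha (lift_mul q j).
Proof.
move=> IJ0 qS jJ e u v uv.
have /asboolP[_ [/asboolP[a [b [aA bI ->]]] piab]] := qS e u v uv.
(* Both [a + b] and the difference of the chosen representatives project to [q u - q v], so they
   agree after multiplication by [j]. *)
have -> : lift_mul q j u - lift_mul q j v = (a + b) * j.
  rewrite -mulrBl; apply: (quo_pi_mulr_eq _ _ _ _ _ _ IJ0 jJ).
  by rewrite piab (raddfB (quo_pi I)) /= !quo_reprK.
(* The term [b * j] vanishes, leaving [a * j] in [alpha e]. *)
by rewrite mulrDl (ideal_mul_eq0 _ _ _ _ _ IJ0 bI jJ) addr0 ideal_mulr.
Qed.

Theorem theorem3p3 (R : comPzRingType) (G : graph)
    (alpha : edge_labeling G R) (I J : ideal R)
    (IJ0 : forall x : R, (x \in I) && (x \in J) = (x == 0)) :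
  (forall q : vertex G -> quoring I, is_spline (quo_labeling I alpha) q ->
   forall j : R, j \in J ->
     (forall x : vertex G -> R, (forall u, q u = quo_pi I (x u)) ->
        forall u, lift_mul q j u = x u * j) /\
     is_spline alpha (lift_mul q j))
  /\
  (inhabited (vertex G) ->
   (forall r : R, r \in ideal_sum I J) ->
   exists! j0 : R, j0 \in J /\
     forall q : vertex G -> quoring I, is_spline (quo_labeling I alpha) q ->
       forall u, quo_pi I (lift_mul q j0 u) = q u).
Proof.
split=> [q qS j jJ | [u0] IJ1].
  split; last exact: is_spline_lift_mul IJ0 qS jJ.
  by move=> x qx u; apply: (quo_pi_mulr_eq _ _ _ _ _ _ IJ0 jJ); rewrite quo_reprK.
have /asboolP[i0 [j0 [i0I j0J def1]]] := IJ1 1.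
have pij0 : quo_pi I j0 = 1.
  by rewrite -(rmorph1 (quo_pi I)); apply/esym/eqP; rewrite quo_piE def1 addrK.
exists j0; split=> [|j1 [j1J j1S]].
  by split=> // q _ u; rewrite quo_pi_lift_mul pij0 mulr1.
(* The constant spline must be evaluated at some vertex, here [u0]: with no vertices, every element
   of [J] would qualify. *)
have := j1S _ (is_spline_const _ _ (quo_labeling I alpha) 1) u0.
rewrite quo_pi_lift_mul mul1r -pij0 => /esym/eqP; rewrite quo_piE => j01I.
by apply/eqP; rewrite -subr_eq0 -IJ0 j01I rpredB.
Qed.
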